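(* Let ${\bf i}\in\mathbb S^2$ and $f\in\mathcal{SR}(\mathbb D^4)\cap C(\overline{\mathbb D^4},\mathbb H)$. In each item the sign $\pm$ is fixed and is the same in the hypothesis on $q$ and in the conclusion. 1. Let $\omega$ be a regular majorant such that $\|f\|\in{}_{\bf i}\Lambda_\omega(\mathbb S^3)$. If $f\in{}_{\bf i}\Lambda_\omega(\mathbb D^4)$, then there is a constant $C>0$, independent of $q$, such that for every $q=q_0+{\bf q}\in\mathbb D^4$ satisfying $$\langle q,e^{{\bf i}t}\rangle\le q_0\cos t\pm|{\bf q}|\sin t,\qquad\forall t\in[0,2\pi],$$ one has $$P_{\bf i}[\|f\|](q)-2\|f(q_0\pm{\bf i}|{\bf q}|)\|\le C\,\omega(1-\|q\|).$$ 2. Let $\omega_1,\omega_2$ be two regular majorants such that $\|f\|\in{}_{\bf i}\Lambda_{\omega_1,\omega_2}(\mathbb S^3)$. If $f\in{}_{\bf i}\Lambda_{\omega_1,\omega_2}(\mathbb D^4)$, then there is a constant $C>0$, independent of $q$, such that for every $q=q_0+{\bf q}\in\mathbb D^4$ satisfying $$\langle q,e^{{\bf i}t}\rangle\le q_0\cos t\pm|{\bf q}|\sin t,\qquad\forall t\in[0,2\pi],$$ one has $$P_{\bf i}[\|f\|](q)-2\|f(q_0\pm{\bf i}|{\bf q}|)\|\le C\big(\omega_1(1-\|q\|)+\omega_2(1-\|q\|)\big).$$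
   Context: $\mathbb H$ is the skew field of quaternions with Euclidean norm $\|\cdot\|$ and Euclidean inner product $\langle\cdot,\cdot\rangle$ (that of $\mathbb R^4$); every $q\in\mathbb H$ is $q=q_0+{\bf q}$ with real part $q_0$ and vector (purely imaginary) part ${\bf q}$, whose norm is written $|{\bf q}|$. $\mathbb D^4=\{q\in\mathbb H:\|q\|<1\}$, $\mathbb S^3=\{q\in\mathbb H:\|q\|=1\}$; $\mathbb S^2$ is the set of purely imaginary quaternions of norm $1$. For ${\bf i}\in\mathbb S^2$ put $\mathbb C({\bf i})=\{x+{\bf i}y: x,y\in\mathbb R\}\cong\mathbb C$, $\mathbb D_{\bf i}=\mathbb D^4\cap\mathbb C({\bf i})$, and let $\mathbb S_{\bf i}=\mathbb S^3\cap\mathbb C({\bf i})=\{e^{{\bf i}t}:t\in[0,2\pi]\}$ be the unit circle of $\mathbb C({\bf i})$. Regular majorant: a continuous function $\omega:[0,2]\to\mathbb R_+$ with $\omega(0)=0$, $\omega$ increasing, $\omega(t)/t$ decreasing, and such that for some constant $C>0$, $\int_0^x\frac{\omega(t)}{t}dt+x\int_x^2\frac{\omega(t)}{t^2}dt\le C\omega(x)$ for $0<x<2$. $\mathcal{SR}(\mathbb D^4)$ is the set of (left) slice regular functions: real differentiable $f:\mathbb D^4\to\mathbb H$ such that for every ${\bf k}\in\mathbb S^2$, $\frac12\left(\frac{\partial}{\partial x}+{\bf k}\frac{\partial}{\partial y}\right)f(x+{\bf k}y)=0$ on $\mathbb D_{\bf k}$. $f\in\mathcal{SR}(\mathbb D^4)\cap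 C(\overline{\mathbb D^4},\mathbb H)$ means that $f$ is slice regular in $\mathbb D^4$ and continuous on the closed ball. Function classes ($C,C_1,C_2$ denote positive constants depending on $f$ but not on $x,y$): - ${}_{\bf i}\Lambda_\omega(\mathbb D^4)$ (resp. ${}_{\bf i}\Lambda_\omega(\mathbb S^3)$): all $f:\mathbb D^4\to\mathbb H$ (resp. $f:\mathbb S^3\to\mathbb H$) with $\|f(x)-f(y)\|\le C\omega(\|x-y\|)$ for all $x,y\in\mathbb D_{\bf i}$ (resp. $x,y\in\mathbb S_{\bf i}$). - ${}_{\bf i}\Lambda_{\omega_1,\omega_2}(\mathbb D^4)$ (resp. ${}_{\bf i}\Lambda_{\omega_1,\omega_2}(\mathbb S^3)$): all $f:\mathbb D^4\to\mathbb H$ (resp. $f:\mathbb S^3\to\mathbb H$) such that, writing $f=f_1+f_2{\bf j}$ on $\mathbb D_{\bf i}$ (resp. $\mathbb S_{\bf i}$) with $f_1,f_2$ valued in $\mathbb C({\bf i})$ and ${\bf j}\in\mathbb S^2$ orthogonal to ${\bf i}$, one has $\|f_k(x)-f_k(y)\|\le C_k\omega_k(\|x-y\|)$ for all $x,y\in\mathbb D_{\bf i}$ (resp. $\mathbb S_{\bf i}$), $k=1,2$ (independent of the choice of ${\bf j}$). $\|f\|$ denotes the real-valued function $q\mapsto\|f(q)\|$, regarded as $\mathbb H$-valued and, for the $\mathbb S^3$ classes, restricted to $\mathbb S^3$. ${\bf i}$-Poisson integral of a continuous real function $u$ on $\mathbb S_{\bf i}$: $P_{\bf i}[u](q)=\frac1{2\pi}\int_0^{2\pi}u(e^{{\bf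 i}t})\frac{1-\|q\|^2}{\|q-e^{{\bf i}t}\|^2}dt$, $q\in\mathbb D^4$. *)

(* Defs.v *)
From HB Require Import structures.
From mathcomp Require Import all_boot all_order all_algebra.
From mathcomp Require Import all_classical all_reals all_analysis.
Set Implicit Arguments.
Unset Strict Implicit.
Unset Printing Implicit Defensive.
Import Order.TTheory GRing.Theory Num.Theory.
Import numFieldNormedType.Exports.
Local Open Scope classical_set_scope.
Local Open Scope ring_scope.

(* Quaternions a + b e1 + c e2 + d e3 are row vectors (a, b, c, d), so that
   'rV[R]_4 provides the real vector space, topology and Frechet derivative.
   The library norm `|q| on 'rV[R]_4 is the sup norm: it induces the right
   topology, but the Euclidean norm is qnorm. *)
Notation quat R := 'rV[R]_4.

Section Quaternions.
Context {R : realType}.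
Implicit Types (p q k : quat R) (x y : R).

Definition mkq (a b c d : R) : quat R := \row_(n < 4) nth 0 [:: a; b; c; d] n.

Definition qmul p q : quat R :=
  let: (a, b, c, d) := (p 0 0, p 0 1, p 0 2, p 0 3) in
  let: (a', b', c', d') := (q 0 0, q 0 1, q 0 2, q 0 3) in
  mkq (a * a' - b * b' - c * c' - d * d')
      (a * b' + b * a' + c * d' - d * c')
      (a * c' - b * d' + c * a' + d * b')
      (a * d' + b * c' - c * b' + d * a').

Definition qreal x : quat R := mkq x 0 0 0.
Definition qre q : R := q 0 0.
Definition qvec q : quat R := q - qreal (qre q).

Definition qdot p q : R := \sum_(n < 4) p 0 n * q 0 n.
Definition qnorm q : R := Num.sqrt (qdot q q).

Definition D4 : set (quat R) := [set q | qnorm q < 1].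
Definition closedD4 : set (quat R) := [set q | qnorm q <= 1].
Definition S3 : set (quat R) := [set q | qnorm q = 1].
Definition S2 : set (quat R) := [set q | qre q = 0 /\ qnorm q = 1].

(* x + k y *)
Definition cplx k x y : quat R := qreal x + y *: k.

Definition Cslice k : set (quat R) := [set q | exists x y, q = cplx k x y].

(* e^{k t} *)
Definition qexp k (t : R) : quat R := cplx k (cos t) (sin t).

(* Only the values of f on D4 matter, since D4 is open. *)
Definition slice_regular (f : quat R -> quat R) : Prop :=
  (forall q, D4 q -> differentiable f q) /\
  (forall k, S2 k -> forall x y, D4 (cplx k x y) ->
     2^-1 *: (derive1 (fun s : R => f (cplx k s y)) x
              + qmul k (derive1 (fun s : R => f (cplx k x s)) y)) = 0).

(* Only the values of w on [0, 2] matter.  The two integrands are nonnegative,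
   so the extended-real inequality also says that the integrals are finite. *)
Definition regular_majorant (w : R -> R) : Prop :=
  [/\ {within `[0, 2], continuous w},
      w 0 = 0 /\ (forall t : R, 0 <= t <= 2 -> 0 <= w t),
      (forall s t : R, 0 <= s -> s <= t -> t <= 2 -> w s <= w t),
      (forall s t : R, 0 < s -> s <= t -> t <= 2 -> w t / t <= w s / s) &
      exists C : R, 0 < C /\ forall x, 0 < x < 2 ->
        ((\int[lebesgue_measure]_(t in `]0%R, x]) (w t / t)%:E)
         + x%:E * (\int[lebesgue_measure]_(t in `[x, 2%R]) (w t / t ^+ 2)%:E)
         <= (C * w x)%:E)%E].

(* With A := D4 or A := S3, A `&` Cslice i is the disc, respectively the
   circle, of the slice C(i). *)
Definition lip_slice (i : quat R) (w : R -> R) (A : set (quat R))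
    (f : quat R -> quat R) : Prop :=
  exists C : R, 0 < C /\ forall p q,
    (A `&` Cslice i) p -> (A `&` Cslice i) q ->
    qnorm (f p - f q) <= C * w (qnorm (p - q)).

(* The choice of j is immaterial: another choice multiplies f2 by a unit
   complex number of C(i). *)
Definition lip_slice2 (i : quat R) (w1 w2 : R -> R) (A : set (quat R))
    (f : quat R -> quat R) : Prop :=
  exists j : quat R, [/\ S2 j, qdot i j = 0 &
    exists f1 f2 : quat R -> quat R,
      [/\ forall q, (A `&` Cslice i) q ->
            [/\ Cslice i (f1 q), Cslice i (f2 q) & f q = f1 q + qmul (f2 q) j],
          lip_slice i w1 A f1 &
          lip_slice i w2 A f2]].

Definition poisson (i : quat R) (u : quat R -> R) (q : quat R) : R :=
  (2 * pi)^-1 * \int[lebesgue_measure]_(t in `[0, 2 * pi])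
    (u (qexp i t) * ((1 - qnorm q ^+ 2) / qnorm (q - qexp i t) ^+ 2)).

End Quaternions.

(* Main.v *)
Require Import Defs.
From HB Require Import structures.
From mathcomp Require Import all_boot all_order all_algebra.
From mathcomp Require Import all_classical all_reals all_analysis.
From mathcomp Require Import ring lra.
Import Order.TTheory GRing.Theory Num.Theory.
Import numFieldNormedType.Exports.
Local Open Scope classical_set_scope.
Local Open Scope ring_scope.

(* The hypothesis on q, taken at t = pi/2 and t = 3pi/2, is the equality case
   of Cauchy-Schwarz and forces q = q_0 + sg i |q| to lie in the slice C(i),
   so only the disc of C(i) matters.  There the Lipschitz estimate for f
   extends by continuity to the circle, and since the Poisson kernel has mass
   one, P[|f|](q) - |f(q)| is at most the Poisson integral at q of
   w(|q - e^{it}|).  With d = 1 - |q|, the kernel is at most 2d / |q - e^{it}|^2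
   and |q - e^{it}| dominates both d and a multiple of the angle between q and
   e^{it}, so this is controlled by d \int_d^2 w(s)/s^2 ds, which is at most
   a multiple of w(d) because w is a regular majorant. *)

(** * Calculus on the line *)

Local Notation mu := lebesgue_measure.

Section RealAnalysis.
Context {R : realType}.
Implicit Types (a b x t u : R) (F G : R -> R).

Lemma continuous_integrable a b F :
  continuous F -> (mu : measure _ R).-integrable `[a, b] (EFin \o F).
Proof.
move=> cF; apply: continuous_compact_integrable; first exact: segment_compact.
exact: continuous_subspaceT.
Qed.

Lemma integral_antiderivative F G a b : a <= b -> continuous G ->
  (forall x, a <= x <= b -> is_derive x 1 F (G x)) ->
  \int[mu]_(x in `[a, b]) G x = F b - F a.
Proof.
rewrite le_eqVlt => /predU1P[-> _ _|ab cG dF].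
  by rewrite set_itv1 Rintegral_set1 subrr.
have cF x : a <= x <= b -> {for x, continuous F}.
  move=> /dF dFx; apply: differentiable_continuous; apply/derivable1_diffP.
  exact: ex_derive.
rewrite /Rintegral (@continuous_FTC2 _ G F)//.
- exact: continuous_subspaceT.
- split.
  + move=> x; rewrite in_itv/= => /andP[ax xb].
    by have := dF x; rewrite !ltW// => /(_ isT) ?; exact: ex_derive.
  + by apply: cvg_at_right_filter; apply: cF; rewrite lexx ltW.
  + by apply: cvg_at_left_filter; apply: cF; rewrite lexx ltW.
- move=> x; rewrite in_itv/= => /andP[ax xb]; rewrite derive1E.
  by have := dF x; rewrite !ltW// => /(_ isT) ?; rewrite derive_val.
Qed.

(** The open interval makes every derivative two-sided. It is later taken larger than the range of
    integration, so that the endpoints of that range are interior points. *)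
Lemma continuous_antiderivative a b G : continuous G ->
  exists F, forall x, a < x < b -> is_derive x 1 F (G x).
Proof.
move=> cG; exists (fun x => \int[mu]_(t in `[a, x]) G t) => x /andP[ax xb].
have [dF F'] := continuous_FTC1_closed xb (continuous_integrable a b _ cG) ax (cG x).
apply: DeriveDef; first exact: dF.
by rewrite -derive1E; exact: F'.
Qed.

(** On [[0, pi / 4]] the cosine is at least 1/2, so the mean value theorem gives [y / 2 <= sin y].
    The claim follows from [sin x = 2 sin (x / 2) cos (x / 2)]. *)
Lemma le_sin_quarter x : 0 <= x <= pi / 2 -> x / 4 <= sin x.
Proof.
move=> /andP[x0 xpi].
have half (y : R) : 0 <= y <= pi / 4 -> 2^-1 <= cos y /\ y / 2 <= sin y.
  have lec (z : R) : 0 <= z <= pi / 4 -> 2^-1 <= cos z.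
    move=> /andP[z0 zpi]; have pi0 := @pi_gt0 R.
    have c0 : 0 < cos z by apply: cos_gt0_pihalf; apply/andP; split; lra.
    (* The duplication formula turns this sign into [cos z ^+ 2 >= 1 / 2]. *)
    have c2 : 0 <= cos (2 * z).
      by apply: cos_ge0_pihalf; apply/andP; split; lra.
    have : cos (2 * z) = 2 * cos z ^+ 2 - 1.
      by rewrite mulr_natl mulr2n cosD -!expr2 sin2cos2; ring.
    by nra.
  move=> /andP[y0 ypi]; split; first by apply: lec; rewrite y0.
  have [c] := @MVT_segment R sin cos 0 y y0 (fun x _ => is_derive_sin x)
    (continuous_subspaceT (@continuous_sin R)).
  rewrite in_itv/= => /andP[c0 cy]; rewrite sin0 !subr0 => ->.
  have := lec c; rewrite c0 (le_trans cy ypi) => /(_ isT) ?.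
  by rewrite [y / 2]mulrC; exact: ler_wpM2r.
have [|c s] := half (x / 2).
  by apply/andP; split; lra.
have -> : sin x = 2 * sin (x / 2) * cos (x / 2).
  rewrite [in LHS](_ : x = x / 2 + x / 2); last by field.
  by rewrite sinD; ring.
nra.
Qed.

(** By parity take [u >= 0]; then [1 - cos u = 2 sin (u / 2) ^+ 2], and [sin (u / 2)] is at least
    [u / 8]. *)
Lemma le_onem_cos u : - (pi : R) <= u <= pi -> (u / 8) ^+ 2 * 2 <= 1 - cos u.
Proof.
wlog u0 : u / 0 <= u.
  move=> H; have [u0|u0] := leP 0 u; first exact: H.
  move=> /andP[? ?]; rewrite -cosN -[_ / 8]opprK -mulNr sqrrN.
  by apply: H; [lra|apply/andP; split; lra].
move=> /andP[_ upi].
have := @le_sin_quarter (u / 2).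
rewrite divr_ge0//= ler_pM2r ?invr_gt0// upi => /(_ isT) h.
have -> : cos u = 1 - 2 * sin (u / 2) ^+ 2.
  rewrite [in LHS](_ : u = u / 2 + u / 2); last by field.
  by rewrite cosD -!expr2 cos2sin2; ring.
by nra.
Qed.

(** Retraction of the line onto a segment: precomposing with it makes a majorant, continuous only
    within [[0, 2]], continuous everywhere. *)
Definition clamp a b x : R := Num.max a (Num.min b x).

Lemma continuous_clamp a b : continuous (clamp a b).
Proof.
move=> x; apply: continuous_max; first exact: cvg_cst.
by apply: continuous_min; [exact: cvg_cst|exact: cvg_id].
Qed.

Lemma clamp_ge a b x : a <= clamp a b x.
Proof. by rewrite le_max lexx. Qed.

Lemma clamp_le a b x : a <= b -> clamp a b x <= b.
Proof. by move=> ab; rewrite ge_max ab ge_min lexx. Qed.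

Lemma clamp_id a b x : a <= x <= b -> clamp a b x = x.
Proof. by move=> /andP[ax xb]; rewrite /clamp min_r// max_r. Qed.

End RealAnalysis.

(** * The Poisson kernel *)

Section PoissonKernel.
Context {R : realType}.
Implicit Types (a b t r : R).

Definition sqdist_circle a b t : R := (a - cos t) ^+ 2 + (b - sin t) ^+ 2.

Lemma sqdist_circle_gt0 a b t : a ^+ 2 + b ^+ 2 < 1 -> 0 < sqdist_circle a b t.
Proof.
move=> ab; rewrite lt_def addr_ge0 ?sqr_ge0// andbT.
apply: contraTneq ab => /eqP; rewrite paddr_eq0 ?sqr_ge0// !sqrf_eq0 !subr_eq0.
by move=> /andP[/eqP -> /eqP ->]; rewrite cos2Dsin2 ltxx.
Qed.

Lemma continuous_sqdist_circle a b : continuous (sqdist_circle a b).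
Proof.
move=> t; apply: cvgD; apply: (@cvgM _ _ _ _); apply: cvgB;
  by [exact: cvg_cst|exact: continuous_cos|exact: continuous_sin].
Qed.

(* With [z = (a + i b) e^{-it}], the antiderivative is
   [t - 2 arg (1 - z)], since the kernel is [1 + 2 Re (z / (1 - z))]. *)
Lemma integral_poisson_kernel a b : a ^+ 2 + b ^+ 2 < 1 ->
  \int[mu]_(t in `[0, 2 * pi]) ((1 - (a ^+ 2 + b ^+ 2)) / sqdist_circle a b t)
    = 2 * pi.
Proof.
move=> ab.
(* Here [D + i N = 1 - z]. Since [D > 0], this point stays in the right half-plane, where its
   argument is [atan (N / D)]. *)
pose D t : R := 1 - a * cos t - b * sin t; pose N t : R := a * sin t - b * cos t.
have D0 t : 0 < D t.
  have cs := cos2Dsin2 t.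
  suff : a * cos t + b * sin t < 1 by rewrite /D; lra.
  have : (a * cos t + b * sin t) ^+ 2 < 1.
    have : (a * cos t + b * sin t) ^+ 2 + N t ^+ 2 < 1.
      rewrite (_ : _ + _ = (a ^+ 2 + b ^+ 2) * (cos t ^+ 2 + sin t ^+ 2)).
        by rewrite cs mulr1.
      by rewrite /N; ring.
    by apply: le_lt_trans; rewrite lerDl sqr_ge0.
  by set m := _ + _; nra.
pose F t : R := t + 2 * atan (N t / D t).
transitivity (F (2 * pi) - F 0); last first.
  (* The arctangent term is periodic, so only the linear term contributes. *)
  rewrite /F (_ : N (2 * pi) / D (2 * pi) = N 0 / D 0); first by ring.
  by rewrite /N /D mulr_natl cos2pi sin2pi cos0 sin0.
apply: integral_antiderivative; first by rewrite mulr_ge0 ?pi_ge0.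
- move=> t; apply: cvgM; first exact: cvg_cst.
  by apply: cvgV; [rewrite gt_eqF// sqdist_circle_gt0|exact: continuous_sqdist_circle].
- move=> t _.
  have dN : is_derive t 1 N (1 - D t).
    rewrite (_ : N = a *: sin - b *: cos); last by apply/funext.
    by apply: is_derive_eq; rewrite /GRing.scale /= /D; ring.
  have dD : is_derive t 1 D (N t).
    rewrite (_ : D = cst 1 - a *: cos - b *: sin); last by apply/funext.
    by apply: is_derive_eq; rewrite /GRing.scale /= /N; ring.
  have dV : is_derive t 1 (fun t => (D t)^-1) (- (D t)^-2 *: N t).
    by apply: is_deriveV; rewrite gt_eqF.
  have dQ : is_derive t 1 (fun t => N t / D t) ((1 - D t) / D t - N t ^+ 2 / D t ^+ 2).
    rewrite (_ : (fun t => _) = N * (fun t => (D t)^-1)); last by apply/funext.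
    apply: is_derive_eq.
    by have := D0 t; rewrite /GRing.scale /= => d; field; rewrite gt_eqF.
  have dA := @is_derive1_comp _ atan (fun t => N t / D t) t _ _ (is_derive1_atan _) dQ.
  rewrite (_ : F = id + 2 *: (atan \o (fun t => N t / D t))); last by apply/funext.
  have dZ := @is_deriveZ _ _ _ _ 2 t 1 _ dA.
  apply: (@is_derive_eq _ _ _ _ _ _ _ _
    (@is_deriveD _ _ _ _ _ _ _ _ _ (is_derive_id t 1) dZ)).
  have cs := cos2Dsin2 t.
  (* This is [|q - e^{it}| = |1 - z|]; the two sides differ by a multiple of
     [cos t ^+ 2 + sin t ^+ 2 - 1]. *)
  have E : sqdist_circle a b t = D t ^+ 2 + N t ^+ 2.
    transitivity (sqdist_circle a b t
      + (a ^+ 2 + b ^+ 2 - 1) * (cos t ^+ 2 + sin t ^+ 2 - 1)).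
      by rewrite cs subrr mulr0 addr0.
    by rewrite /sqdist_circle /D /N; ring.
  have E' : a ^+ 2 + b ^+ 2 = (1 - D t) ^+ 2 + N t ^+ 2.
    by rewrite -[LHS]mulr1 -[X in _ * X = _]cs /D /N; ring.
  have := sqdist_circle_gt0 a b t ab; rewrite E E' /GRing.scale /= => p.
  by have := D0 t => d; field; rewrite !gt_eqF.
Qed.

End PoissonKernel.

(** * Regular majorants *)

(** Transfers relative continuity, of a majorant on [[0, 2]] or of [f] on the closed ball, to
    ordinary continuity along a map with values in that set. *)
Lemma continuous_comp_within (T U V : topologicalType) (A : set U)
    (g : T -> U) (h : U -> V) :
  continuous g -> (forall x, A (g x)) -> {within A, continuous h} ->
  continuous (h \o g).
Proof.
move=> cg Ag /subspace_continuousP ch x.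
apply: (@cvg_comp _ _ _ _ _ _ (within A (nbhs (g x)))); last exact: ch.
move=> B wB; change (nbhs x (g @^-1` B)).
apply: (@filterS _ _ _ (g @^-1` (fun y => A y -> B y)) _ _ (cg x _ wB)).
by move=> z /(_ (Ag z)).
Qed.

Section Majorant.
Context {R : realType}.
Implicit Types (a b r s t x : R) (w : R -> R).

(** The angle is [acos (a / r)] with the sign of [b], and 0 at the origin. *)
Lemma polar_coordinates a b : exists2 th : R, - pi <= th <= pi &
  a = Num.sqrt (a ^+ 2 + b ^+ 2) * cos th /\
  b = Num.sqrt (a ^+ 2 + b ^+ 2) * sin th.
Proof.
have ab0 : 0 <= a ^+ 2 + b ^+ 2 by rewrite addr_ge0 ?sqr_ge0.
set r := Num.sqrt _; have r2 : r ^+ 2 = a ^+ 2 + b ^+ 2 by rewrite sqr_sqrtr.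
have [r0|r0] := eqVneq r 0.
  exists 0; first by rewrite oppr_le0 pi_ge0.
  move: r2; rewrite r0 expr0n/= !mul0r => /esym/eqP.
  by rewrite paddr_eq0 ?sqr_ge0// !sqrf_eq0 => /andP[/eqP -> /eqP ->].
have rp : 0 < r by rewrite lt_def r0 sqrtr_ge0.
have ar : -1 <= a / r <= 1.
  rewrite -ler_norml normrM normfV (gtr0_norm rp) ler_pdivrMr// mul1r.
  by rewrite -(sqrtr_sqr a) ler_wsqrtr// lerDl sqr_ge0.
have ca : r * cos (acos (a / r)) = a by rewrite acosK ?in_itv//= mulrC divfK.
have sa : r * sin (acos (a / r)) = `|b|.
  rewrite sin_acos// -{1}(gtr0_norm rp) -(sqrtr_sqr r) -sqrtrM ?sqr_ge0//.
  rewrite mulrBr mulr1 -exprMn [r * _]mulrC divfK// -(sqrtr_sqr b).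
  by rewrite r2 addrC addKr.
have [b0|b0] := leP 0 b.
  exists (acos (a / r)); last by rewrite ca sa ger0_norm.
  by rewrite acos_lepi// (le_trans _ (acos_ge0 ar))// oppr_le0 pi_ge0.
exists (- acos (a / r)); last by rewrite cosN sinN ca mulrN sa ltr0_norm// opprK.
by rewrite lerN2 acos_lepi// (le_trans _ (@pi_ge0 R))// oppr_le0 acos_ge0.
Qed.

Lemma sqdist_circle_polar r th t :
  sqdist_circle (r * cos th) (r * sin th) t
    = 1 - 2 * r * cos (t - th) + r ^+ 2.
Proof.
rewrite /sqdist_circle cosB.
transitivity (r ^+ 2 * (cos th ^+ 2 + sin th ^+ 2) + (cos t ^+ 2 + sin t ^+ 2)
  - 2 * r * (cos t * cos th + sin t * sin th)); first by ring.
by rewrite !cos2Dsin2; ring.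
Qed.

(** The first difference is [2 r (1 - cos s)]. For the second, if [cos s >= 0] the right side is
    [(r - cos s)^2 + (1 - cos s)(1 + cos s)], hence at least [1 - cos s]. If [cos s < 0] it is at
    least 1, while [(s / 8) ^+ 2 <= (1 - cos s) / 2 <= 1]. *)
Lemma sqdist_circle_lower r s : 0 <= r -> r < 1 -> - (pi : R) <= s <= pi ->
  (1 - r) ^+ 2 <= 1 - 2 * r * cos s + r ^+ 2 /\
  (s / 8) ^+ 2 <= 1 - 2 * r * cos s + r ^+ 2.
Proof.
move=> r0 r1 /le_onem_cos h.
have c1 := cos_le1 s; have cm := cos_geN1 s.
split; first by nra.
have [c0|c0] := leP 0 (cos s); last by nra.
by have := sqr_ge0 (r - cos s); nra.
Qed.

(* [w s / s ^+ 2] made even and constant for [`|s| <= dl] and for [2 <= `|s|],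
   hence continuous on the whole line. *)
Definition flatten_majorant w dl s : R :=
  w (clamp 0 2 (clamp dl 2 `|s|)) / clamp dl 2 `|s| ^+ 2.

Lemma continuous_clamp_comp w : {within `[0, 2], continuous w} ->
  continuous (w \o clamp 0 2).
Proof.
apply: continuous_comp_within => [|x]; first exact: continuous_clamp.
by rewrite /= in_itv/= clamp_ge clamp_le.
Qed.

Lemma continuous_flatten_majorant w dl : {within `[0, 2], continuous w} ->
  0 < dl -> continuous (flatten_majorant w dl).
Proof.
move=> cw dl0 s.
have cc : {for s, continuous (fun s => clamp dl 2 `|s|)}.
  by apply: (continuous_comp (@norm_continuous _ _ s)); exact: continuous_clamp.
apply: cvgM.
  apply: (@continuous_comp _ _ _ (fun s => clamp dl 2 `|s|) (w \o clamp 0 2)).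
    exact: cc.
  exact: continuous_clamp_comp.
apply: cvgV; first by rewrite expf_neq0// gt_eqF// (lt_le_trans dl0)// clamp_ge.
apply: (@continuous_comp _ _ _ (fun s => clamp dl 2 `|s|) (fun x => x ^+ 2)).
  exact: cc.
exact: exprn_continuous.
Qed.

(** The integral is expressed through an antiderivative [Phi], so that translates of the integrand
    can be integrated without a change of variables. The range [[- 3 pi, 3 pi]] contains all the
    translated angles needed later. *)
Lemma integral_flatten_majorant w : regular_majorant w ->
  exists2 C : R, 0 < C & forall dl : R, 0 < dl <= 1 ->
  exists Phi, (forall s, `|s| < 4 * pi ->
      is_derive s 1 Phi (flatten_majorant w dl s)) /\
    Phi (3 * pi) - Phi (- (3 * pi)) <= C * (w dl / dl).
Proof.
move=> [cw [w0 wge0] wmono wdec [C [C0 hC]]].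
have pi2 := @pi_ge2 R.
(* The factor 2 comes from evenness; the three summands come from [[0, dl]], [[dl, 2]] and
   [[2, 3 pi]]. *)
exists (2 * (1 + C + 3 * pi / 2)); first by lra.
move=> dl /andP[dl0 dl1].
have cH := continuous_flatten_majorant w dl cw dl0.
have [Phi dPhi'] := continuous_antiderivative (- (4 * pi)) (4 * pi) _ cH.
have dPhi s : `|s| < 4 * pi -> is_derive s 1 Phi (flatten_majorant w dl s).
  by rewrite ltr_norml => ?; exact: dPhi'.
exists Phi; split=> //.
have ftc x y : - (3 * pi) <= x -> x <= y -> y <= 3 * pi ->
    \int[mu]_(s in `[x, y]) flatten_majorant w dl s = Phi y - Phi x.
  move=> x3 xy y3; apply: integral_antiderivative => // s /andP[xs sy].
  by apply: dPhi; rewrite ltr_norml; apply/andP; split; lra.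
(* As the integrand is even, [- Phi (- s)] is another antiderivative of it. *)
have neg : Phi 0 - Phi (- (3 * pi)) = Phi (3 * pi) - Phi 0.
  rewrite -(ftc 0 (3 * pi)) ?oppr_le0; try lra.
  have -> : Phi 0 - Phi (- (3 * pi)) = (- (Phi \o -%R)) (3 * pi) - (- (Phi \o -%R)) 0.
    by rewrite !fctE /= oppr0; ring.
  apply/esym/integral_antiderivative => //; first by lra.
  move=> s /andP[s0 s3].
  have dN : is_derive (- s) 1 Phi (flatten_majorant w dl s).
    have -> : flatten_majorant w dl s = flatten_majorant w dl (- s).
      by rewrite /flatten_majorant normrN.
    by apply: dPhi; rewrite normrN ger0_norm//; lra.
  have := @is_deriveN _ _ _ _ _ _ _
    (@is_derive1_comp _ Phi -%R s _ _ dN (is_deriveNid s 1)).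
  by rewrite mulrN1 opprK.
have wdl0 : 0 <= w dl by apply: wge0; lra.
have p1 : Phi dl - Phi 0 <= w dl / dl.
  rewrite -ftc; try lra.
  rewrite (@eq_Rintegral _ _ _ _ _ (cst (w dl / dl ^+ 2))).
    rewrite Rintegral_cst//= lebesgue_measure_itv/= lte_fin dl0 -EFinD/= subr0.
    by rewrite expr2 invfM mulrA divfK// gt_eqF.
  move=> s; rewrite inE/= in_itv/= => /andP[s0 sdl].
  rewrite /flatten_majorant (ger0_norm s0).
  have -> : clamp dl 2 s = dl by rewrite /clamp min_r ?max_l//; lra.
  by rewrite clamp_id//; lra.
have p3 : Phi (3 * pi) - Phi 2 <= 3 * pi / 2 * (w dl / dl).
  rewrite -ftc; try lra.
  rewrite (@eq_Rintegral _ _ _ _ _ (cst (w 2 / 2 ^+ 2))).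
    rewrite Rintegral_cst//= lebesgue_measure_itv/= lte_fin.
    rewrite ifT; last by lra.
    have : w 2 / 2 <= w dl / dl by apply: wdec; lra.
    have : 0 <= w 2 by apply: wge0; lra.
    rewrite -EFinD/=; set W := w dl / dl.
    by nra.
  move=> s; rewrite inE/= in_itv/= => /andP[s0 sdl].
  rewrite /flatten_majorant ger0_norm; last by lra.
  have -> : clamp dl 2 s = 2 by rewrite /clamp min_l ?max_r//; lra.
  by rewrite clamp_id//; lra.
have p2 : Phi 2 - Phi dl <= C * (w dl / dl).
  rewrite -ftc; try lra.
  have hdl : 0 < dl < 2 by lra.
  have := hC _ hdl.
  have -> : (\int[mu]_(t in `[dl, 2%R]) (w t / t ^+ 2)%:E =
      (\int[mu]_(s in `[dl, 2]) flatten_majorant w dl s)%:E)%E.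
    rewrite /Rintegral fineK.
      apply: eq_integral => s; rewrite inE/= in_itv/= => /andP[s0 s2].
      rewrite /flatten_majorant ger0_norm; last by lra.
      by rewrite !clamp_id//; lra.
    by apply: integrable_fin_num => //; exact: continuous_integrable.
  (* With this sign, the majorant inequality bounds the integral over [[dl, 2]] alone. *)
  have i0 : (0 <= \int[mu]_(t in `]0%R, dl]) (w t / t)%:E)%E.
    apply: integral_ge0 => t; rewrite /= in_itv/= => /andP[t0 tdl].
    by rewrite lee_fin divr_ge0 ?(ltW t0)//; apply: wge0; lra.
  move=> h; have := le_trans (leeDr _ i0) h.
  by rewrite -EFinM lee_fin mulrA ler_pdivlMr// mulrC.
lra.
Qed.

End Majorant.

(** * Poisson integral of a majorant of the distance *)

Section PoissonMajorant.
Context {R : realType}.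
Implicit Types (a b r s t x : R) (w : R -> R).

Lemma flatten_majorant_ge0 w (dl s : R) : regular_majorant w -> 0 < dl <= 2 ->
  0 <= flatten_majorant w dl s.
Proof.
move=> [_ [_ w0] _ _ _] /andP[dl0 dl2]; rewrite divr_ge0 ?sqr_ge0//.
by apply: w0; rewrite clamp_ge clamp_le.
Qed.

(** With [c] the clamped value of [|s|], both lower bounds on [d] give [c / 8 <= d]. Since [w x / x]
    decreases and [w] increases, [w d / d <= 8 w c / c]; with [1 / d <= 8 / c] this makes the factor
    64. *)
Lemma le_flatten_majorant w (dl d s : R) : regular_majorant w ->
  0 < dl -> dl <= d -> d <= 2 -> `|s| / 8 <= d ->
  w d / d ^+ 2 <= 64 * flatten_majorant w dl s.
Proof.
move=> [_ [_ w0] wmono wdec _] dl0 dld d2 sd; rewrite /flatten_majorant.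
have dl2 : dl <= 2 by lra.
set c := clamp dl 2 `|s|.
have cl : dl <= c by exact: clamp_ge.
have c2 : c <= 2 by exact: clamp_le.
have cd : c / 8 <= d.
  have : c <= Num.max dl `|s|.
    rewrite ge_max le_max lexx le_max; apply/orP; right.
    by rewrite ge_min lexx orbT.
  by rewrite le_max => /orP[|]; lra.
rewrite clamp_id; last by apply/andP; split; lra.
have c0 : 0 < c by lra.
have d0 : 0 < d by lra.
have h1 : w d / d <= 8 * (w c / c).
  have /le_trans : w d / d <= w (c / 8) / (c / 8) by apply: wdec; lra.
  apply; have -> : 8 * (w c / c) = w c / (c / 8) by field; rewrite gt_eqF.
  by rewrite ler_pM2r ?invr_gt0//; [apply: wmono|]; lra.
have h2 : d^-1 <= 8 * c^-1.
  by rewrite -[8]invrK -invfM lef_pV2 ?posrE//; lra.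
have -> : w d / d ^+ 2 = w d / d * d^-1 by field; rewrite gt_eqF.
have -> : 64 * (w c / c ^+ 2) = 8 * (w c / c) * (8 * c^-1).
  by field; rewrite gt_eqF.
apply: ler_pM => //; rewrite ?invr_ge0 ?(ltW d0)//.
by rewrite divr_ge0 ?(ltW d0)//; apply: w0; lra.
Qed.

Definition majorant_kernel w a b t : R :=
  w (clamp 0 2 (Num.sqrt (sqdist_circle a b t)))
    * ((1 - (a ^+ 2 + b ^+ 2)) / sqdist_circle a b t).

Lemma continuous_poisson_kernel a b : a ^+ 2 + b ^+ 2 < 1 ->
  continuous (fun t => (1 - (a ^+ 2 + b ^+ 2)) / sqdist_circle a b t).
Proof.
move=> ab t; apply: cvgM; first exact: cvg_cst.
apply: cvgV; first by rewrite gt_eqF// sqdist_circle_gt0.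
exact: continuous_sqdist_circle.
Qed.

Lemma continuous_majorant_kernel w a b : {within `[0, 2], continuous w} ->
  a ^+ 2 + b ^+ 2 < 1 -> continuous (majorant_kernel w a b).
Proof.
move=> cw ab t; apply: cvgM; last exact: continuous_poisson_kernel.
have cs : {for t, continuous (Num.sqrt \o sqdist_circle a b)}.
  apply: continuous_comp; first exact: continuous_sqdist_circle.
  exact: sqrt_continuous.
apply: (@continuous_comp _ _ _ (Num.sqrt \o sqdist_circle a b) (w \o clamp 0 2)).
  exact: cs.
exact: continuous_clamp_comp.
Qed.

(** In polar coordinates the kernel depends only on [t - th]; it is dominated by translates of the
    flattened majorant, whose integral is known. *)
Lemma integral_majorant_kernel w : regular_majorant w ->
  exists2 K : R, 0 < K & forall a b, a ^+ 2 + b ^+ 2 < 1 ->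
    \int[mu]_(t in `[0, 2 * pi]) majorant_kernel w a b t
      <= K * w (1 - Num.sqrt (a ^+ 2 + b ^+ 2)).
Proof.
move=> hw; have [C C0 hC] := integral_flatten_majorant w hw.
have cw : {within `[0, 2], continuous w} by case: hw.
(* Here 128 is 64 from the pointwise comparison times 2 from [1 - r ^+ 2 <= 2 * dl]. *)
exists (128 * C) => [|a b ab]; first by lra.
have pi2 := @pi_ge2 R.
have [th thpi] := polar_coordinates a b.
set r := Num.sqrt _ => -[aE bE].
have r0 : 0 <= r by exact: sqrtr_ge0.
have r2 : a ^+ 2 + b ^+ 2 = r ^+ 2.
  by rewrite sqr_sqrtr// addr_ge0 ?sqr_ge0.
have r1 : r < 1 by rewrite r2 in ab; nra.
pose dl := 1 - r.
have dl0 : 0 < dl by rewrite /dl; lra.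
have dl1 : dl <= 1 by rewrite /dl; lra.
have [|Phi [dPhi hPhi]] := hC dl; first by rewrite dl0.
have cH := continuous_flatten_majorant w dl cw dl0.
have H0 s : 0 <= flatten_majorant w dl s.
  by apply: flatten_majorant_ge0 => //; apply/andP; split; lra.
have mono x y : - (3 * pi) <= x -> x <= y -> y <= 3 * pi -> Phi x <= Phi y.
  move=> x3 xy y3; rewrite -subr_ge0.
  suff <- : \int[mu]_(s in `[x, y]) flatten_majorant w dl s = Phi y - Phi x.
    exact: Rintegral_ge0.
  apply: integral_antiderivative => // s /andP[xs sy]; apply: dPhi.
  by rewrite ltr_norml; apply/andP; split; lra.
(* Since [t - th] lies in [[- pi, 3 pi]], either it or its shift by [- 2 pi] falls in [[- pi, pi]].
   Summing the two nonnegative terms avoids splitting the integral. *)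
pose H2 t := 128 * dl *
  (flatten_majorant w dl (t - th) + flatten_majorant w dl (t - th - 2 * pi)).
pose F t := 128 * dl * (Phi (t - th) + Phi (t - th - 2 * pi)).
have cH2 : continuous H2.
  move=> t; apply: cvgM; first exact: cvg_cst.
  apply: cvgD.
    apply: (@continuous_comp _ _ _ (fun t => t - th)); last exact: cH.
    by apply: cvgB; [exact: cvg_id|exact: cvg_cst].
  apply: (@continuous_comp _ _ _ (fun t => t - th - 2 * pi)); last exact: cH.
  by apply: cvgB; [apply: cvgB; [exact: cvg_id|exact: cvg_cst]|exact: cvg_cst].
have cos_period (u : R) : cos (u - 2 * pi) = cos u.
  by rewrite mulr_natl -[LHS]cosD2pi subrK.
have pointwise (t : R) : 0 <= t <= 2 * pi -> majorant_kernel w a b t <= H2 t.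
  move=> /andP[t0 t2].
  rewrite /majorant_kernel.
  have S0 := sqdist_circle_gt0 a b t ab.
  set S := sqdist_circle a b t in S0 *.
  have SE : S = 1 - 2 * r * cos (t - th) + r ^+ 2.
    by rewrite /S {1}aE {1}bE sqdist_circle_polar.
  pose d := Num.sqrt S.
  have d0 : 0 < d by rewrite sqrtr_gt0.
  have dS : d ^+ 2 = S by rewrite sqr_sqrtr// ltW.
  have d2 : d <= 2.
    rewrite -(@ler_pXn2r _ 2)// ?nnegrE ?(ltW d0)// dS SE.
    by have := cos_geN1 (t - th); nra.
  have lower u : - pi <= u <= pi -> cos (t - th) = cos u ->
      w d / d ^+ 2 <= 64 * flatten_majorant w dl u.
    move=> upi cE; have := sqdist_circle_lower r u r0 r1 upi.
    rewrite -cE -SE => -[l1 l2].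
    apply: le_flatten_majorant => //.
      by rewrite -(@ler_pXn2r _ 2)// ?nnegrE ?(ltW d0) ?(ltW dl0)// dS.
    rewrite -(@ler_pXn2r _ 2)// ?nnegrE ?(ltW d0) ?divr_ge0// dS.
    by rewrite exprMn real_normK ?num_real// -exprMn.
  have g : w d / d ^+ 2 <= 64 * (flatten_majorant w dl (t - th)
      + flatten_majorant w dl (t - th - 2 * pi)).
    have h1 := H0 (t - th); have h2 := H0 (t - th - 2 * pi).
    have [tp|tp] := leP (t - th) pi.
      have tm : - pi <= t - th by lra.
      by have := lower (t - th); rewrite tm tp => /(_ isT erefl); lra.
    have := lower (t - th - 2 * pi).
    rewrite [cos (t - th - 2 * pi)]cos_period.
    by move=> h; have := h _ erefl; lra.
  rewrite -/d clamp_id; last by rewrite (ltW d0).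
  rewrite r2 /H2.
  have -> : w d * ((1 - r ^+ 2) / S) = (1 - r ^+ 2) * (w d / d ^+ 2).
    by rewrite dS; ring.
  have r12 : 1 - r ^+ 2 <= 2 * dl by rewrite /dl; nra.
  have g0 : 0 <= w d / d ^+ 2.
    rewrite divr_ge0 ?sqr_ge0//; case: hw => _ [_ w0] _ _ _.
    by apply: w0; rewrite (ltW d0).
  apply: (le_trans (ler_wpM2r g0 r12)).
  rewrite (_ : 128 * dl = 2 * dl * 64); last by ring.
  by rewrite -mulrA ler_wpM2l//; lra.
apply: (@le_trans _ _ (\int[mu]_(t in `[0, 2 * pi]) H2 t)).
  apply: le_Rintegral => //.
  - by apply: continuous_integrable; exact: continuous_majorant_kernel.
  - exact: continuous_integrable.
have -> : \int[mu]_(t in `[0, 2 * pi]) H2 t = F (2 * pi) - F 0.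
  apply: integral_antiderivative; [by lra|exact: cH2|move=> t /andP[t0 t2]].
  have d1 : is_derive (t - th) 1 Phi (flatten_majorant w dl (t - th)).
    by apply: dPhi; rewrite ltr_norml; apply/andP; split; lra.
  have d2 : is_derive (t - th - 2 * pi) 1 Phi
      (flatten_majorant w dl (t - th - 2 * pi)).
    by apply: dPhi; rewrite ltr_norml; apply/andP; split; lra.
  have shift x : is_derive t 1 (fun t => t - x) 1.
    have := @is_deriveB _ _ _ id (cst x) t 1 _ _ (is_derive_id t 1) (is_derive_cst x t 1).
    by rewrite subr0.
  have shift2 : is_derive t 1 (fun t => t - th - 2 * pi) 1.
    by under eq_fun do rewrite -addrA -opprD.
  have c1 := @is_derive1_comp _ Phi (fun t => t - th) t _ _ d1 (shift th).
  have c2 := @is_derive1_comp _ Phi (fun t => t - th - 2 * pi) t _ _ d2 shift2.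
  have := @is_deriveZ _ _ _ _ (128 * dl) t 1 _ (@is_deriveD _ _ _ _ _ _ _ _ _ c1 c2).
  by rewrite !mulr1.
(* The two translated intervals abut at [- th], so the sum telescopes. *)
have -> : F (2 * pi) - F 0
    = 128 * dl * (Phi (2 * pi - th) - Phi (0 - th - 2 * pi)).
  by rewrite /F (_ : 2 * pi - th - 2 * pi = 0 - th); ring.
have P1 : Phi (2 * pi - th) <= Phi (3 * pi) by apply: mono; lra.
have P2 : Phi (- (3 * pi)) <= Phi (0 - th - 2 * pi) by apply: mono; lra.
have : 128 * dl * (Phi (2 * pi - th) - Phi (0 - th - 2 * pi))
    <= 128 * dl * (C * (w dl / dl)) by apply: ler_wpM2l; lra.
move=> /le_trans; apply.
by rewrite le_eqVlt; apply/orP; left; apply/eqP; rewrite /dl; field; rewrite gt_eqF.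
Qed.

End PoissonMajorant.

(** * Quaternions and slices *)

Section Quaternions.
Context {R : realType}.
Implicit Types (p q i j : quat R) (a b x y t : R).

Lemma quat_eq p q : p 0 0 = q 0 0 -> p 0 1 = q 0 1 -> p 0 2 = q 0 2 ->
  p 0 3 = q 0 3 -> p = q.
Proof.
move=> h0 h1 h2 h3; apply/rowP => -[[|[|[|[|//]]]] hn].
- by rewrite (_ : Ordinal hn = 0) //; exact: val_inj.
- by rewrite (_ : Ordinal hn = 1) //; exact: val_inj.
- by rewrite (_ : Ordinal hn = 2) //; exact: val_inj.
- by rewrite (_ : Ordinal hn = 3) //; exact: val_inj.
Qed.

Lemma qdotE p q : qdot p q =
  p 0 0 * q 0 0 + p 0 1 * q 0 1 + p 0 2 * q 0 2 + p 0 3 * q 0 3.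
Proof.
rewrite /qdot !big_ord_recl big_ord0 addr0 !addrA.
by congr (_ + _ + _ + _); congr (p 0 _ * q 0 _); exact: val_inj.
Qed.

Lemma qdot_ge0 q : 0 <= qdot q q.
Proof. by rewrite qdotE -!expr2 !addr_ge0 ?sqr_ge0. Qed.

Lemma qnorm_ge0 q : 0 <= qnorm q.
Proof. exact: sqrtr_ge0. Qed.

Lemma sqr_qnorm q : qnorm q ^+ 2 = qdot q q.
Proof. by rewrite sqr_sqrtr ?qdot_ge0. Qed.

Lemma qnormN q : qnorm (- q) = qnorm q.
Proof. by rewrite /qnorm !qdotE !mxE !mulrNN. Qed.

Lemma qnormBC p q : qnorm (p - q) = qnorm (q - p).
Proof. by rewrite -qnormN opprB. Qed.

(** Cauchy-Schwarz through Lagrange's identity: the defect is a sum of six squares. *)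
Lemma qdot_le p q : qdot p q <= qnorm p * qnorm q.
Proof.
apply: (le_trans (ler_norm _)); rewrite -sqrtrM ?qdot_ge0// -sqrtr_sqr.
apply: ler_wsqrtr; rewrite !qdotE -subr_ge0.
set a := p 0 0; set b := p 0 1; set c := p 0 2; set d := p 0 3.
set a' := q 0 0; set b' := q 0 1; set c' := q 0 2; set d' := q 0 3.
rewrite (_ : _ - _ = (a * b' - b * a') ^+ 2 + (a * c' - c * a') ^+ 2
  + (a * d' - d * a') ^+ 2 + (b * c' - c * b') ^+ 2
  + (b * d' - d * b') ^+ 2 + (c * d' - d * c') ^+ 2); last by ring.
by rewrite !addr_ge0 ?sqr_ge0.
Qed.

Lemma ler_qnormD p q : qnorm (p + q) <= qnorm p + qnorm q.
Proof.
rewrite -(@ler_pXn2r _ 2)// ?nnegrE ?addr_ge0 ?qnorm_ge0//.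
have h := qdot_le p q.
have -> : qnorm (p + q) ^+ 2 = qnorm p ^+ 2 + qnorm q ^+ 2 + 2 * qdot p q.
  by rewrite !sqr_qnorm !qdotE !mxE; ring.
have -> : (qnorm p + qnorm q) ^+ 2
    = qnorm p ^+ 2 + qnorm q ^+ 2 + 2 * (qnorm p * qnorm q) by ring.
by rewrite lerD2l ler_wpM2l.
Qed.

(** Euler's four-square identity with an imaginary unit factor. *)
Lemma qnorm_qmulr p j : S2 j -> qnorm (qmul p j) = qnorm p.
Proof.
move=> [j0 j1]; rewrite /qnorm; congr Num.sqrt.
have : qdot j j = 1 by rewrite -sqr_qnorm j1 expr1n.
move: j0; rewrite /qre => j0; rewrite !qdotE !mxE /= j0 => jj.
rewrite -[RHS]mulr1 -jj; ring.
Qed.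

Lemma cplx0 i x y : S2 i -> cplx i x y 0 0 = x.
Proof. by move=> [+ _]; rewrite /qre !mxE => ->; rewrite mulr0 addr0. Qed.

Lemma qdot_cplx i q x y : S2 i -> qdot q (cplx i x y) = qre q * x + y * qdot q i.
Proof.
by move=> [+ _]; rewrite /qre !qdotE !mxE /= => ->; ring.
Qed.

Lemma qnorm_cplx i x y : S2 i -> qnorm (cplx i x y) = Num.sqrt (x ^+ 2 + y ^+ 2).
Proof.
move=> hi; have [i0 i1] := hi; rewrite /qnorm; congr Num.sqrt.
have jj : qdot i i = 1 by rewrite -sqr_qnorm i1 expr1n.
rewrite qdot_cplx// /qre cplx0//.
have -> : qdot (cplx i x y) i = y * qdot i i.
  by move: i0; rewrite /qre !qdotE !mxE /= => ->; ring.
by rewrite jj; ring.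
Qed.

Lemma sqr_qnorm_cplx i x y : S2 i -> qnorm (cplx i x y) ^+ 2 = x ^+ 2 + y ^+ 2.
Proof. by move=> hi; rewrite qnorm_cplx// sqr_sqrtr// addr_ge0 ?sqr_ge0. Qed.

Lemma cplxB i x y x' y' : cplx i x y - cplx i x' y' = cplx i (x - x') (y - y').
Proof.
by apply: quat_eq; rewrite !mxE /=; ring.
Qed.

Lemma qnorm_qexp i t : S2 i -> qnorm (qexp i t) = 1.
Proof. by move=> hi; rewrite qnorm_cplx// cos2Dsin2 sqrtr1. Qed.

Lemma qnorm_sub_qexp i a b t : S2 i ->
  qnorm (cplx i a b - qexp i t) = Num.sqrt (sqdist_circle a b t).
Proof. by move=> hi; rewrite cplxB qnorm_cplx. Qed.

(* Testing the hypothesis at [t = pi/2] and [t = 3pi/2] gives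
   [<q, i> = sg |q|], the equality case of Cauchy-Schwarz. *)
Lemma slice_constraint i q (sg : bool) : S2 i ->
  (forall t, 0 <= t <= 2 * pi -> qdot q (qexp i t)
     <= qre q * cos t + (-1) ^+ sg * (qnorm (qvec q) * sin t)) ->
  q = cplx i (qre q) ((-1) ^+ sg * qnorm (qvec q)).
Proof.
move=> hi hq; set n := qnorm (qvec q) in hq *; set s : R := (-1) ^+ sg in hq *.
have s2 : s ^+ 2 = 1 by rewrite sqrr_sign.
have pi0 := @pi_gt0 R.
have qi : qdot q i = s * n.
  apply/eqP; rewrite eq_le; apply/andP; split.
    have := hq (pi / 2); rewrite qdot_cplx// cos_pihalf sin_pihalf.
    have H : 0 <= (pi : R) / 2 <= 2 * (pi : R) by lra.
    by move=> /(_ H); rewrite !mulr0 !add0r mul1r mulr1.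
  have := hq (pi / 2 + pi); rewrite qdot_cplx// cosDpi sinDpi.
  rewrite cos_pihalf sin_pihalf.
  have H : 0 <= (pi : R) / 2 + pi <= 2 * (pi : R) by lra.
  by move=> /(_ H); rewrite oppr0 !mulr0 !add0r mulN1r mulrN1 mulrN lerN2.
have nn : n ^+ 2 = q 0 1 ^+ 2 + q 0 2 ^+ 2 + q 0 3 ^+ 2.
  by rewrite sqr_qnorm qdotE !mxE /= /qre; ring.
have [i0 i1] := hi.
have ii : i 0 1 ^+ 2 + i 0 2 ^+ 2 + i 0 3 ^+ 2 = 1.
  have : qdot i i = 1 by rewrite -sqr_qnorm i1 expr1n.
  by rewrite qdotE; move: i0; rewrite /qre => ->; rewrite -!expr2 expr0n add0r.
have : (q 0 1 - s * n * i 0 1) ^+ 2 + (q 0 2 - s * n * i 0 2) ^+ 2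
    + (q 0 3 - s * n * i 0 3) ^+ 2 = 0.
  have e : s * n = q 0 1 * i 0 1 + q 0 2 * i 0 2 + q 0 3 * i 0 3.
    by rewrite -qi qdotE; move: i0; rewrite /qre => ->; ring.
  transitivity (q 0 1 ^+ 2 + q 0 2 ^+ 2 + q 0 3 ^+ 2
      - 2 * (s * n) * (q 0 1 * i 0 1 + q 0 2 * i 0 2 + q 0 3 * i 0 3)
      + (s * n) ^+ 2 * (i 0 1 ^+ 2 + i 0 2 ^+ 2 + i 0 3 ^+ 2)).
    by ring.
  rewrite -e ii -nn mulr1.
  transitivity (n ^+ 2 * (1 - s ^+ 2)); first by ring.
  by rewrite s2 subrr mulr0.
move=> /eqP; rewrite !paddr_eq0 ?addr_ge0 ?sqr_ge0// !sqrf_eq0 !subr_eq0.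
move=> /andP[/andP[/eqP h1 /eqP h2] /eqP h3].
apply: quat_eq; first by rewrite cplx0.
- by rewrite [LHS]h1 !mxE /= add0r.
- by rewrite [LHS]h2 !mxE /= add0r.
- by rewrite [LHS]h3 !mxE /= add0r.
Qed.

(** * Boundary values and the Poisson estimate on a slice *)

Lemma continuous_qnorm : continuous (@qnorm R).
Proof.
move=> q; apply: (@continuous_comp _ _ _ (fun q => qdot q q) Num.sqrt).
  have c n : {for q, continuous (fun q : quat R => q 0 n * q 0 n)}.
    by apply: (@continuousM R (quat R)); exact: (@coord_continuous R 1 4 0 n q).
  rewrite (_ : (fun q => qdot q q) = (fun q => q 0 0 * q 0 0 + q 0 1 * q 0 1
    + q 0 2 * q 0 2 + q 0 3 * q 0 3)); last by apply/funext => ?; exact: qdotE.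
  exact: (cvgD (cvgD (cvgD (c 0) (c 1)) (c 2)) (c 3)).
exact: sqrt_continuous.
Qed.

Lemma cplxE i x y : cplx i x y = x *: qreal 1 + y *: i.
Proof. by congr (_ + _); apply: quat_eq; rewrite !mxE /= ?mulr1 ?mulr0. Qed.

Lemma continuous_cplx i (u v : R -> R) : continuous u -> continuous v ->
  continuous (fun t => cplx i (u t) (v t)).
Proof.
move=> cu cv t; under eq_fun do rewrite cplxE.
by apply: cvgD; (apply: cvgZ; [|exact: cvg_cst]); [exact: cu|exact: cv].
Qed.

Lemma continuous_boundary i (f : quat R -> quat R) : S2 i ->
  {within closedD4, continuous f} -> continuous (fun t => f (qexp i t)).
Proof.
move=> hi hfc.
apply: (@continuous_comp_within _ _ _ closedD4 (qexp i) f) => //.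
  by apply: continuous_cplx; [exact: continuous_cos|exact: continuous_sin].
by move=> t; rewrite /closedD4/= qnorm_qexp.
Qed.

(** The boundary point is approached along its radius [s e^{it}], and the inequality passes to the
    limit as [s] tends to 1 from the left. Distances inside the disc are below 2, where the clamp is
    the identity. *)
Lemma lipschitz_boundary i (f : quat R -> quat R) (W : R -> R) : S2 i ->
  {within closedD4, continuous f} -> {within `[0, 2], continuous W} ->
  (forall p q, (D4 `&` Cslice i) p -> (D4 `&` Cslice i) q ->
    qnorm (f p - f q) <= W (qnorm (p - q))) ->
  forall p t, (D4 `&` Cslice i) p ->
    qnorm (f p - f (qexp i t)) <= W (clamp 0 2 (qnorm (p - qexp i t))).
Proof.
move=> hi hfc cW lipf p t [Dp Cp].
pose g s : quat R := cplx i (clamp 0 1 s * cos t) (clamp 0 1 s * sin t).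
have cg : continuous g.
  by apply: continuous_cplx => s; apply: cvgM; [exact: continuous_clamp|
    exact: cvg_cst|exact: continuous_clamp|exact: cvg_cst].
have ng s : qnorm (g s) = clamp 0 1 s.
  rewrite qnorm_cplx// !exprMn -mulrDr cos2Dsin2 mulr1 sqrtr_sqr ger0_norm//.
  exact: clamp_ge.
have cfg : continuous (f \o g).
  apply: (@continuous_comp_within _ _ _ closedD4) => // s.
  by rewrite /closedD4/= ng clamp_le.
have g1 : g 1 = qexp i t by rewrite /g clamp_id ?ler01 ?lexx// !mul1r.
pose L s := qnorm (f p - f (g s)); pose M s := W (clamp 0 2 (qnorm (p - g s))).
have cL : continuous L.
  move=> s; apply: (@continuous_comp _ _ _ (fun s => f p - f (g s)) (@qnorm R)).
    by apply: cvgB; [exact: cvg_cst|exact: cfg].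
  exact: continuous_qnorm.
have cM : continuous M.
  move=> s.
  apply: (@continuous_comp _ _ _ (fun s => qnorm (p - g s)) (W \o clamp 0 2)).
    apply: (@continuous_comp _ _ _ (fun s => p - g s) (@qnorm R)).
      by apply: cvgB; [exact: cvg_cst|exact: cg].
    exact: continuous_qnorm.
  exact: continuous_clamp_comp.
rewrite -g1 -/(L 1) -/(M 1).
apply: (ler_cvg_to (cvg_at_left_filter (cL 1)) (cvg_at_left_filter (cM 1))).
near=> s.
have s0 : 0 < s by near: s; exact: nbhs_left_gt.
have s1 : s < 1 by near: s; exact: nbhs_left_lt.
have ns : qnorm (g s) < 1 by rewrite ng clamp_id// !ltW.
have Dg : (D4 `&` Cslice i) (g s).
  by split => //; exists (clamp 0 1 s * cos t), (clamp 0 1 s * sin t).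
rewrite /L /M clamp_id; first exact: lipf.
rewrite qnorm_ge0/=; apply: (le_trans (ler_qnormD _ _)).
by rewrite qnormN; move: Dp; rewrite /D4/=; lra.
Unshelve. all: by end_near. Qed.

(** Integrates [|f(e^{it})| <= |f(q)| + C1 w1 + C2 w2], the majorants taken at [|q - e^{it}|],
    against the kernel. Two majorants with possibly zero constants cover both items at once. *)
Lemma poisson_le i (f : quat R -> quat R) (w1 w2 : R -> R) (C1 C2 : R) :
  S2 i -> {within closedD4, continuous f} ->
  regular_majorant w1 -> regular_majorant w2 -> 0 <= C1 -> 0 <= C2 ->
  (forall p q, (D4 `&` Cslice i) p -> (D4 `&` Cslice i) q ->
    qnorm (f p - f q) <= C1 * w1 (qnorm (p - q)) + C2 * w2 (qnorm (p - q))) ->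
  exists2 C : R, 0 < C & forall x y : R, let q := cplx i x y in D4 q ->
    poisson i (fun p => qnorm (f p)) q - qnorm (f q)
      <= C * (w1 (1 - qnorm q) + w2 (1 - qnorm q)).
Proof.
move=> hi hfc hw1 hw2 C10 C20 lipf.
have cw1 : {within `[0, 2], continuous w1} by case: hw1.
have cw2 : {within `[0, 2], continuous w2} by case: hw2.
pose W x := C1 * w1 x + C2 * w2 x.
have cW : {within `[0, 2], continuous W}.
  move=> x; apply: cvgD; (apply: cvgM; first exact: cvg_cst).
    exact: cw1.
  exact: cw2.
have [K1 K10 hK1] := integral_majorant_kernel w1 hw1.
have [K2 K20 hK2] := integral_majorant_kernel w2 hw2.
have CK1 : 0 <= C1 * K1 by rewrite mulr_ge0// ltW.
have CK2 : 0 <= C2 * K2 by rewrite mulr_ge0// ltW.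
(* The summand 1 keeps the constant positive when [C1] and [C2] vanish. *)
exists (C1 * K1 + C2 * K2 + 1); first by lra.
move=> a b q Dq.
have q2 : qnorm q ^+ 2 = a ^+ 2 + b ^+ 2 by rewrite sqr_qnorm_cplx.
have q0 := qnorm_ge0 q; have q1 : qnorm q < 1 by [].
have ab : a ^+ 2 + b ^+ 2 < 1 by rewrite -q2; nra.
set P := fun t => (1 - (a ^+ 2 + b ^+ 2)) / sqdist_circle a b t.
have cP : continuous P by exact: continuous_poisson_kernel.
have P0 t : 0 <= P t.
  by apply: divr_ge0; [rewrite subr_ge0 ltW|rewrite ltW// sqdist_circle_gt0].
have iP := continuous_integrable 0 (2 * pi) P cP.
have ck1 := continuous_majorant_kernel w1 a b cw1 ab.
have ck2 := continuous_majorant_kernel w2 a b cw2 ab.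
have ik1 := continuous_integrable 0 (2 * pi) _ ck1.
have ik2 := continuous_integrable 0 (2 * pi) _ ck2.
have intU : \int[mu]_(t in `[0, 2 * pi]) (qnorm (f q) * P t
      + (C1 * majorant_kernel w1 a b t + C2 * majorant_kernel w2 a b t))
    <= qnorm (f q) * (2 * pi) + (C1 * (K1 * w1 (1 - qnorm q))
        + C2 * (K2 * w2 (1 - qnorm q))).
  have cZ (c : R) (h : R -> R) : continuous h -> continuous (fun t => c * h t).
    by move=> ch t; apply: cvgM; [exact: cvg_cst|exact: ch].
  have iZ (c : R) (h : R -> R) : continuous h ->
    (mu : measure _ R).-integrable `[0, 2 * pi] (EFin \o (fun t => c * h t)).
    by move=> ch; apply: continuous_integrable; exact: cZ.
  rewrite RintegralD//; first last.
  - apply: continuous_integrable => t; apply: cvgD; exact: cZ.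
  - exact: iZ.
  rewrite RintegralZl// integral_poisson_kernel// lerD2l RintegralD//; [|exact: iZ..].
  rewrite !RintegralZl// qnorm_cplx//.
  by apply: lerD; apply: ler_wpM2l => //; [exact: hK1|exact: hK2].
have intL : \int[mu]_(t in `[0, 2 * pi]) (qnorm (f (qexp i t))
      * ((1 - qnorm q ^+ 2) / qnorm (q - qexp i t) ^+ 2))
    <= \int[mu]_(t in `[0, 2 * pi]) (qnorm (f q) * P t
      + (C1 * majorant_kernel w1 a b t + C2 * majorant_kernel w2 a b t)).
  have sq t : qnorm (q - qexp i t) ^+ 2 = sqdist_circle a b t.
    by rewrite qnorm_sub_qexp// sqr_sqrtr// ltW// sqdist_circle_gt0.
  rewrite (_ : (fun t => _) = fun t => qnorm (f (qexp i t)) * P t); last first.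
    by apply/funext => t; rewrite sq q2.
  have cf : continuous (fun t => qnorm (f (qexp i t))).
    move=> t; apply: (@continuous_comp _ _ _ (fun t => f (qexp i t)) (@qnorm R)).
      exact: continuous_boundary.
    exact: continuous_qnorm.
  have pointwise (t : R) : qnorm (f (qexp i t)) * P t <= qnorm (f q) * P t
      + (C1 * majorant_kernel w1 a b t + C2 * majorant_kernel w2 a b t).
    rewrite [leRHS](_ : _ = (qnorm (f q)
      + W (clamp 0 2 (Num.sqrt (sqdist_circle a b t)))) * P t); last first.
      by rewrite /majorant_kernel /W /P; ring.
    apply: ler_wpM2r; first exact: P0.
    have Cq : (D4 `&` Cslice i) q by split => //; exists a, b.
    have := lipschitz_boundary i f W hi hfc cW lipf q t Cq.
    rewrite qnorm_sub_qexp// => h.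
    have := ler_qnormD (f q) (f (qexp i t) - f q).
    by rewrite addrC subrK qnormBC; move/le_trans; apply; rewrite lerD2l.
  apply: le_Rintegral => //.
  - by apply: continuous_integrable => t; apply: cvgM; [exact: cf|exact: cP].
  - apply: continuous_integrable => t; apply: cvgD.
      by apply: cvgM; [exact: cvg_cst|exact: cP].
    by apply: cvgD; (apply: cvgM; [exact: cvg_cst|]); [exact: ck1|exact: ck2].
have w1q : 0 <= w1 (1 - qnorm q) by case: hw1 => _ [_ h] _ _ _; apply: h; lra.
have w2q : 0 <= w2 (1 - qnorm q) by case: hw2 => _ [_ h] _ _ _; apply: h; lra.
have pi2 := @pi_ge2 R.
have ipi0 : 0 < (2 * (pi : R))^-1 by rewrite invr_gt0; lra.
have ipi1 : (2 * (pi : R))^-1 <= 1 by rewrite invf_le1; lra.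
rewrite /poisson lerBlDl.
have := ler_wpM2l (ltW ipi0) (le_trans intL intU); move/le_trans; apply.
(* The kernel has mass one, so its term is exactly [|f(q)|] and cancels; in the rest, [1 / (2 pi)]
   is bounded by 1. *)
rewrite mulrDr mulrCA mulVf ?mulr1 ?lerD2l; last by rewrite gt_eqF//; lra.
set X := _ + _.
have X0 : 0 <= X by rewrite addr_ge0// mulr_ge0// mulr_ge0// ltW.
apply: (le_trans (ler_piMl X0 ipi1)); rewrite /X !mulrA.
by nra.
Qed.

End Quaternions.

Theorem corollary3p18 (R : realType) (i : quat R) (f : quat R -> quat R)
    (hi : S2 i) (hf : slice_regular f) (hfc : {within closedD4, continuous f}) :
  (forall (w : R -> R) (sg : bool),
     regular_majorant w ->
     lip_slice i w S3 (fun q => qreal (qnorm (f q))) ->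
     lip_slice i w D4 f ->
     exists C : R, 0 < C /\ forall q : quat R, D4 q ->
       (forall t : R, 0 <= t <= 2 * pi ->
          qdot q (qexp i t)
            <= qre q * cos t + (-1) ^+ sg * (qnorm (qvec q) * sin t)) ->
       poisson i (fun p => qnorm (f p)) q
         - 2 * qnorm (f (cplx i (qre q) ((-1) ^+ sg * qnorm (qvec q))))
       <= C * w (1 - qnorm q))
  /\
  (forall (w1 w2 : R -> R) (sg : bool),
     regular_majorant w1 -> regular_majorant w2 ->
     lip_slice2 i w1 w2 S3 (fun q => qreal (qnorm (f q))) ->
     lip_slice2 i w1 w2 D4 f ->
     exists C : R, 0 < C /\ forall q : quat R, D4 q ->
       (forall t : R, 0 <= t <= 2 * pi ->
          qdot q (qexp i t)
            <= qre q * cos t + (-1) ^+ sg * (qnorm (qvec q) * sin t)) ->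
       poisson i (fun p => qnorm (f p)) q
         - 2 * qnorm (f (cplx i (qre q) ((-1) ^+ sg * qnorm (qvec q))))
       <= C * (w1 (1 - qnorm q) + w2 (1 - qnorm q))).
Proof.
split=> [w sg hw _ [C [C0 hC]]|w1 w2 sg hw1 hw2 _].
  have [|K K0 hK] := poisson_le i f w w C 0 hi hfc hw hw (ltW C0) (lexx 0).
    by move=> p q hp hq; rewrite mul0r addr0; exact: hC.
  exists (2 * K); split=> [|q Dq hq]; first by rewrite mulr_gt0.
  have qE := slice_constraint i q sg hi hq.
  have := hK (qre q) ((-1) ^+ sg * qnorm (qvec q)); rewrite /= -qE => /(_ Dq).
  by have := qnorm_ge0 (f q); lra.
move=> [j [hj _ [f1 [f2 [hf12 [C1 [C10 hC1]] [C2 [C20 hC2]]]]]]].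
have [|K K0 hK] :=
    poisson_le i f w1 w2 C1 C2 hi hfc hw1 hw2 (ltW C10) (ltW C20).
  move=> p q hp hq; have [_ _ ->] := hf12 p hp; have [_ _ ->] := hf12 q hq.
  have -> : f1 p + qmul (f2 p) j - (f1 q + qmul (f2 q) j)
      = f1 p - f1 q + qmul (f2 p - f2 q) j.
    by apply: quat_eq; rewrite !mxE /=; ring.
  apply: (le_trans (ler_qnormD _ _)); rewrite qnorm_qmulr//.
  by apply: lerD; [exact: hC1|exact: hC2].
exists K; split=> // q Dq hq; have qE := slice_constraint i q sg hi hq.
have := hK (qre q) ((-1) ^+ sg * qnorm (qvec q)); rewrite /= -qE => /(_ Dq).
by have := qnorm_ge0 (f q); lra.
Qed.
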